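(* Let $K$ be a field of characteristic zero, let $n\ge 13$, and let $\mathfrak{f}_n$ be the $n$-dimensional filiform nilpotent Lie algebra over $K$ with basis $(e_1,\dots,e_n)$ defined in the context. Let $t_1,t_2,t_3\in\mathrm{End}(\mathfrak{f}_n)$ be the linear maps given, for $x=\sum_{i=1}^n x_ie_i$, by $t_1(x)=x_2e_n$, $t_2(x)=x_2e_{n-1}+x_3e_n$, $t_3(x)=x_2e_{n-2}+x_3e_{n-1}+x_4e_n$. Then $\{\mathrm{ad}(e_1),\ldots,\mathrm{ad}(e_{n-1}),t_1,t_2,t_3\}$ is a basis of $\mathrm{Der}(\mathfrak{f}_n)$. In particular, all derivations of $\mathfrak{f}_n$ are nilpotent.
   Context: $\mathrm{Der}(\mathfrak{g})$ denotes the Lie algebra of derivations of a Lie algebra $\mathfrak{g}$. Definition of $\mathfrak{f}_n$ ($n\ge 13$): it has basis $e_1,\dots,e_n$ and Lie brackets (extended by bilinearity and antisymmetry; it is known that this defines a filiform nilpotent Lie algebra) $$[e_1,e_i]=e_{i+1},\quad 2\le i\le n-1,\qquad [e_1,e_n]=0,$$ $$[e_i,e_j]=\sum_{r=1}^n\Bigl(\sum_{\ell=0}^{\lfloor (j-i-1)/2\rfloor}(-1)^\ell\binom{j-i-\ell-1}{\ell}\alpha_{i+\ell,\,r-j+i+2\ell+1}\Bigr)e_r,\quad 2\le i<j\le n,$$ where the parameters $\alpha_{k,s}$ are all zero (including when an index is outside $\{1,\dots,n\}$) except for $$\alpha_{\ell,2\ell+1}=\frac{3}{\binom{\ell}{2}\binom{2\ell-1}{\ell-1}},\quad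 \ell=2,3,\dots,\Bigl\lfloor\frac{n-1}{2}\Bigr\rfloor,$$ $$\alpha_{3,n-4}=1,\qquad \alpha_{4,n-2}=\frac17+\frac{10}{21}\frac{(n-7)(n-8)}{(n-4)(n-5)},$$ $$\alpha_{4,n}=\frac{22105}{15246}\ \text{ if } n=13,\qquad \alpha_{4,n}=0\ \text{ if } n\ge 14,$$ $$\alpha_{5,n}=\frac1{42}-\frac{70(n-8)}{11(n-2)(n-3)(n-4)(n-5)}+\frac{25}{99}\frac{(n-6)(n-7)(n-8)}{(n-2)(n-3)(n-4)}+\frac5{66}\frac{(n-5)(n-6)}{(n-2)(n-3)}-\frac{65}{1386}\frac{(n-7)(n-8)}{(n-4)(n-5)}.$$ *)

(* Defs.v *)
From HB Require Import structures.
From mathcomp Require Import all_boot all_algebra.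

Set Implicit Arguments.
Unset Strict Implicit.
Unset Printing Implicit Defensive.

Import GRing.Theory.
Local Open Scope ring_scope.

Section Derivations.

Variables (K : fieldType) (V : vectType K).

Definition derivation (br : V -> V -> V) (D : 'End(V)) : Prop :=
  forall x y, D (br x y) = br (D x) y + br x (D y).

Variable br : {bilinear V -> V -> V}.

Definition leibniz_defect (x y : V) (D : 'End(V)) : V :=
  D (br x y) - (br (D x) y + br x (D y)).

Lemma leibniz_defect_is_linear x y : linear (leibniz_defect x y).
Proof.
move=> a D E; rewrite /leibniz_defect !add_lfunE !scale_lfunE.
rewrite linearDl linearDr linearZl_LR linearZr_LR /=.
by rewrite scalerBr scalerDr [RHS]addrACA -opprD; congr (_ - _); rewrite addrACA.
Qed.

HB.instance Definition _ x y :=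
  GRing.isLinear.Build K 'End(V) V _ (leibniz_defect x y)
    (leibniz_defect_is_linear x y).

(* By bilinearity it suffices to impose the Leibniz rule on a basis of V;
   [memDer] shows that this is exactly the space of all derivations. *)
Definition Der : {vspace 'End(V)} :=
  (\bigcap_(i < \dim {:V}) \bigcap_(j < \dim {:V})
     lker (linfun (leibniz_defect (vbasis {:V})`_i (vbasis {:V})`_j)))%VS.

Lemma memDer D : D \in Der <-> derivation br D.
Proof.
split=> [DerD x y | derD]; last first.
  rewrite memvE; apply/subv_bigcapP => i _; apply/subv_bigcapP => j _.
  by rewrite -memvE memv_ker lfunE /= /leibniz_defect derD subrr.
have DerB (i j : 'I_(\dim {:V})) :
    let b := vbasis {:V} in
    D (br b`_i b`_j) = br (D b`_i) b`_j + br b`_i (D b`_j).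
  move: DerD; rewrite memvE => /subv_bigcapP/(_ i isT)/subv_bigcapP/(_ j isT).
  by rewrite -memvE memv_ker lfunE /= subr_eq0 => /eqP.
have DerR (i : 'I_(\dim {:V})) (v : V) (b := vbasis {:V}) :
    D (br b`_i v) = br (D b`_i) v + br b`_i (D v).
  rewrite (coord_vbasis (memvf v)) !linear_sum /=.
  rewrite -big_split; apply: eq_bigr => j _ /=.
  by rewrite !linearZ_LR /= DerB scalerDr.
rewrite (coord_vbasis (memvf x)) linear_sumlz !linear_sum !linear_sumlz /=.
rewrite -big_split; apply: eq_bigr => i _ /=.
by rewrite linearZ /= !linearZl_LR linearZ /= DerR scalerDr.
Qed.

Definition ad (x : V) : 'End(V) := linfun (br x).

Lemma adE x y : ad x y = br x y.
Proof. by rewrite lfunE. Qed.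

Definition nilpotent_end (D : 'End(V)) : Prop :=
  exists m : nat, forall x, iter m D x = 0.

End Derivations.

Section Filiform.

Variables (K : fieldType) (n : nat).

(* Indices are 1-based, as in e_1, ..., e_n; [bv i] is 0 and [co i] vanishes
   when i is outside {1, ..., n}. *)
Definition bv (i : nat) : 'rV[K]_n := \row_(k < n) (k.+1 == i)%N%:R.

Definition co (i : nat) (x : 'rV[K]_n) : K := \sum_(k < n | k.+1 == i) x 0 k.

Definition alpha4n2 : K :=
  let N := n%:R in
  1 / 7 + 10 / 21 * (((N - 7) * (N - 8)) / ((N - 4) * (N - 5))).

(* 22105 / 15246; literals of this size are expanded in unary, which makes the
   [ring] and [field] tactics overflow. *)
Definition alpha4n_13 : K := (22 * 10 ^+ 3 + 105) / (15 * 10 ^+ 3 + 246).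

Definition alpha5n : K :=
  let N := n%:R in
  1 / 42
  - (70 * (N - 8)) / (11 * (N - 2) * (N - 3) * (N - 4) * (N - 5))
  + 25 / 99 * (((N - 6) * (N - 7) * (N - 8)) / ((N - 2) * (N - 3) * (N - 4)))
  + 5 / 66 * (((N - 5) * (N - 6)) / ((N - 2) * (N - 3)))
  - 65 / 1386 * (((N - 7) * (N - 8)) / ((N - 4) * (N - 5))).

(* The cases are mutually exclusive for n >= 13. *)
Definition alpha (k s : nat) : K :=
  if (2 <= k <= n.-1./2)%N && (s == 2 * k + 1)%N then
    3 / ('C(k, 2)%:R * 'C(2 * k - 1, k - 1)%:R)
  else if (k == 3)%N && (s == n - 4)%N then 1
  else if (k == 4)%N && (s == n - 2)%N then alpha4n2
  else if (k == 4)%N && (s == n) then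
    (if (n == 13)%N then alpha4n_13 else 0)
  else if (k == 5)%N && (s == n) then alpha5n
  else 0.

(* The second index of alpha, r - j + i + 2 l + 1, is at most n in the range of
   the sums; when it is negative, truncated subtraction yields the index 0,
   where alpha vanishes as well. *)
Definition strc (i j r : nat) : K :=
  \sum_(0 <= l < ((j - i - 1)./2).+1)
    (-1) ^+ l * 'C(j - i - l - 1, l)%:R
    * alpha (i + l)%N (r + i + 2 * l + 1 - j)%N.

Definition brb_lt (i j : nat) : 'rV[K]_n :=
  if (i == 1)%N then (if (j < n)%N then bv j.+1 else 0)
  else \sum_(1 <= r < n.+1) strc i j r *: bv r.

Definition brb (i j : nat) : 'rV[K]_n :=
  if (i < j)%N then brb_lt i j else if (j < i)%N then - brb_lt j i else 0.

Definition fbr (x y : 'rV[K]_n) : 'rV[K]_n :=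
  \sum_(1 <= i < n.+1) \sum_(1 <= j < n.+1) (co i x * co j y) *: brb i j.

Lemma co_is_linear i : scalar (co i).
Proof.
move=> a x y; rewrite /co mulr_sumr -big_split /=.
by apply: eq_bigr => k _; rewrite !mxE.
Qed.

HB.instance Definition _ i :=
  GRing.isLinear.Build K 'rV[K]_n K _ (co i) (co_is_linear i).

Lemma fbr_is_bilinear : bilinear_for *:%R *:%R fbr.
Proof.
split=> u a x y /=; rewrite /fbr scaler_sumr -big_split /=;
  apply: eq_bigr => i _; rewrite scaler_sumr -big_split /=;
  apply: eq_bigr => j _; rewrite linearP /= scalerA -scalerDl; congr (_ *: _).
  by rewrite mulrDl mulrA.
by rewrite mulrDr mulrCA.
Qed.

HB.instance Definition _ :=
  bilinear_isBilinear.Build K 'rV[K]_n 'rV[K]_n 'rV[K]_n *:%R *:%R fbr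
    fbr_is_bilinear.

Lemma co_bv i j : (1 <= j <= n)%N -> co i (bv j) = (i == j)%:R.
Proof.
case: j => // j lt_jn; rewrite /co; under eq_bigr do rewrite mxE.
case: eqP => [-> | /eqP ne_ij].
  by rewrite (big_pred1 (Ordinal lt_jn)) ?eqxx.
by rewrite big1 // => k /eqP->; rewrite (negPf ne_ij).
Qed.

Lemma row_co x : x = \sum_(1 <= i < n.+1) co i x *: bv i.
Proof.
apply/rowP => k; rewrite big_add1 /= big_mkord summxE (bigD1 k) //=.
rewrite !mxE eqxx mulr1 /co (big_pred1 k) // big1 ?addr0 //.
by move=> i ne_ik; rewrite !mxE eqSS eq_sym [_ == _ :> nat](negPf ne_ik) mulr0.
Qed.

Lemma fbr_bv i j : (1 <= i <= n)%N -> (1 <= j <= n)%N ->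
  fbr (bv i) (bv j) = brb i j.
Proof.
move=> lei lej; rewrite /fbr (bigD1_seq i) ?iota_uniq ?mem_index_iota //=.
rewrite (bigD1_seq j) ?iota_uniq ?mem_index_iota //= !co_bv // !eqxx mulr1.
rewrite scale1r big1 => [|k /negPf ne]; last by rewrite co_bv // ne mulr0 scale0r.
rewrite addr0 big1 ?addr0 // => k /negPf ne; rewrite big1 // => l _.
by rewrite co_bv // ne mul0r scale0r.
Qed.

Definition t1_fun (x : 'rV[K]_n) : 'rV[K]_n := co 2 x *: bv n.

Definition t2_fun (x : 'rV[K]_n) : 'rV[K]_n :=
  co 2 x *: bv (n - 1)%N + co 3 x *: bv n.

Definition t3_fun (x : 'rV[K]_n) : 'rV[K]_n :=
  co 2 x *: bv (n - 2)%N + co 3 x *: bv (n - 1)%N + co 4 x *: bv n.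

Lemma t1_is_linear : linear t1_fun.
Proof. by move=> a x y; rewrite /t1_fun co_is_linear scalerDl scalerA. Qed.

Lemma t2_is_linear : linear t2_fun.
Proof.
move=> a x y; rewrite /t2_fun !co_is_linear !scalerDl scalerDr !scalerA.
by rewrite addrACA.
Qed.

Lemma t3_is_linear : linear t3_fun.
Proof.
move=> a x y; rewrite /t3_fun !co_is_linear !scalerDl !scalerDr !scalerA.
by rewrite [X in X + _ = _]addrACA [LHS]addrACA.
Qed.

HB.instance Definition _ :=
  GRing.isLinear.Build K 'rV[K]_n 'rV[K]_n _ t1_fun t1_is_linear.
HB.instance Definition _ :=
  GRing.isLinear.Build K 'rV[K]_n 'rV[K]_n _ t2_fun t2_is_linear.
HB.instance Definition _ :=
  GRing.isLinear.Build K 'rV[K]_n 'rV[K]_n _ t3_fun t3_is_linear.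

Definition t1 : 'End('rV[K]_n) := linfun t1_fun.
Definition t2 : 'End('rV[K]_n) := linfun t2_fun.
Definition t3 : 'End('rV[K]_n) := linfun t3_fun.

End Filiform.

Arguments bv K n i : clear implicits.
Arguments fbr K n x y : clear implicits.
Arguments t1 K n : clear implicits.
Arguments t2 K n : clear implicits.
Arguments t3 K n : clear implicits.

(* Main.v *)
Require Import Defs.
From HB Require Import structures.
From mathcomp Require Import all_boot all_algebra.
From mathcomp Require Import zify ring.

Set Implicit Arguments.
Unset Strict Implicit.
Unset Printing Implicit Defensive.

Import GRing.Theory.
Local Open Scope ring_scope.

(** Put m = n - 11.  The algebra f_n is a deformation of a truncated Witt
    algebra: its brackets are
      [e_i, e_j] = W i j e_(i+j) + A i j e_(i+j+m) + B i j e_(i+j+2m),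
    where W becomes the Witt bracket (j - i) e_(i+j) after rescaling the basis,
    A comes from alpha_(3, n-4), alpha_(4, n-2) and alpha_(5, n), and the second
    order correction B, nonzero for n = 13 only, from alpha_(4, n)
    ([fbr_bvE]).

    That the ad(e_i) are derivations is the Jacobi identity for e_i, e_j, e_k.
    Sort its terms by the index i + j + k + t m that they hit.  For t = 0 this
    is the Jacobi identity of the Witt algebra.  When i = 1 it holds for every
    t, because the binomial sums defining the brackets are the entries of a
    difference table ([alt_step]).  When 2 <= i < j < k and t > 0 the index
    exceeds n except in four cases with t = 1 and one with t = 2; there the
    identity is a relation between rational functions of n, which the remaining
    parameters of f_n were chosen to satisfy
    ([nested_jacobi_order1], [nested_jacobi_order2]).  The maps t_i are
    derivations because they shift indices so far that they kill [e_i, e_j] for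
    2 <= i < j, as do the brackets of their values ([derivation_shift]).

    Conversely e_1 and e_2 generate f_n, so that a derivation D is known from
    D e_1 and D e_2.  Subtracting multiples of the proposed basis leaves
    D e_1 = a e_1 + b e_2 and removes from D e_2 its components along e_3,
    e_(n-2), e_(n-1) and e_n.  Now apply D to [e_2, e_3] = e_5.  In the k-th
    coordinate of D e_2 the resulting equation is triangular with diagonal
    coefficient (k - 3) (k^2 - 3 k + 8) / ((k - 1) k (k + 1)), nonzero for
    k > 3; it leaves b = 0 and D e_2 = 2 a e_2 ([normalised_De2]).  Thus D is a
    multiple of the grading e_i |-> i e_i of the Witt algebra.  The correction
    - e_(n-4) in [e_2, e_5] is not homogeneous, and forces (n - 11) a = 0
    ([normalised_derivation_eq0]).

    Nilpotency follows, since every member of the basis strictly raises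
    indices. *)

(** * Difference tables *)

Section DifferenceTable.

Variable K : fieldType.
Implicit Types (a : nat -> K) (d i j : nat).

(** The alternating binomial sums in the definition of f_n solve the recurrence
    below, which says that bracketing with e_1 is a derivation: the row d = 1
    holds the brackets of neighbours e_i, e_(i+1), the row d those of
    e_i, e_(i+d). *)
Fixpoint tab a d i : K :=
  if d is d1.+1 then
    if d1 is d2.+1 then tab a d1 i - tab a d2 i.+1 else a i
  else 0.

Lemma tabSS a d i : tab a d.+2 i = tab a d.+1 i - tab a d i.+1.
Proof. by []. Qed.

(** Pascal's rule turns the sum for gap d + 2 into the recurrence. *)
Lemma tab_sum a d i :
  tab a d i = \sum_(0 <= l < d) (-1) ^+ l * 'C(d - l - 1, l)%:R * a (i + l)%N.
Proof.
elim/ltn_ind: d i => -[|[|d]] IH i; first by rewrite big_geq.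
  by rewrite big_nat1 expr0 bin0 !mul1r addn0.
rewrite tabSS !IH // [RHS]big_nat_recl // [X in _ = _ + X]big_nat_recr //=.
rewrite [X in _ = _ + (_ + X)](_ : _ = 0); last first.
  by rewrite bin_small ?mulr0 ?mul0r //; lia.
rewrite addr0 big_nat_recl // !bin0 -addrA; congr (_ + _).
rewrite -sumrB; apply: eq_big_nat => l /andP[_ lt_ld].
have -> : (d.+2 - l.+1 - 1 = (d - l - 1).+1)%N by lia.
have -> : (d.+1 - l.+1 - 1 = d - l - 1)%N by lia.
by rewrite binS natrD addSnnS exprS; ring.
Qed.

(** The binomial coefficients vanish beyond the middle of the range. *)
Lemma tab_sum_half a d i : (0 < d)%N ->
  tab a d i = \sum_(0 <= l < ((d - 1)./2).+1)
    (-1) ^+ l * 'C(d - l - 1, l)%:R * a (i + l)%N.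
Proof.
move=> d0; rewrite tab_sum (@big_cat_nat _ _ _ ((d - 1)./2).+1) //=; last by lia.
rewrite [X in _ + X]big_nat_cond [X in _ + X]big1 ?addr0 // => l.
by rewrite andbT => lt_l; rewrite bin_small ?mulr0 ?mul0r //; lia.
Qed.

(** Antisymmetric extension of the table to all pairs of indices; one of the two
    truncated differences is 0, and with it one of the two terms.  Brackets with
    e_1 get no correction, whence the value 0 there. *)
Definition alt a i j : K :=
  if (1 < i)%N && (1 < j)%N then tab a (j - i) i - tab a (i - j) j else 0.

Lemma alt_anti a i j : alt a j i = - alt a i j.
Proof. by rewrite /alt andbC; case: ifP; rewrite ?opprB ?oppr0. Qed.

Lemma alt1 a j : alt a 1 j = 0. Proof. by []. Qed.

Lemma altii a i : alt a i i = 0.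
Proof. by rewrite /alt subrr if_same. Qed.

Lemma alt_lt a i j : (1 < i < j)%N -> alt a i j = tab a (j - i) i.
Proof.
move=> ij; rewrite /alt (_ : (i - j = 0)%N) ?subr0; last by lia.
by case: ifP => //; lia.
Qed.

(** The identity that makes ad(e_1) a derivation in each degree. *)
Lemma alt_step a i j : (1 < i)%N -> (1 < j)%N ->
  alt a i.+1 j + alt a i j.+1 = alt a i j.
Proof.
wlog lt_ij : i j / (i < j)%N => [Hwlog|] i1 j1.
  have [lt|lt|->] := ltngtP i j; first exact: Hwlog.
    by rewrite -[LHS]opprK opprD -!alt_anti addrC Hwlog // -alt_anti.
  by rewrite -[alt a j j.+1]opprK -alt_anti subrr /alt subnn subrr if_same.
rewrite (@alt_lt _ i j); last by lia.
rewrite (@alt_lt _ i j.+1); last by lia.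
have -> : (j.+1 - i = (j - i.+1).+2)%N by lia.
rewrite tabSS (_ : (j - i.+1).+1 = j - i)%N; last by lia.
rewrite addrC /alt ltnS (ltnW i1) j1 /= (_ : i.+1 - j = 0)%N; last by lia.
by rewrite subr0 subrK.
Qed.

End DifferenceTable.

(** * Structure constants of the Witt algebra *)

Section WittConstants.

Variable K : fieldType.
Hypothesis charK0 : [pchar K] =i pred0.
Implicit Types (i j k s : nat).

Lemma natr_neq0 k : (0 < k)%N -> k%:R != 0 :> K.
Proof. by rewrite (pcharf0P K).1 // lt0n. Qed.

(** If E_i is the basis of the Witt algebra with [E_i, E_j] = (j - i) E_(i+j),
    then e_i = weight i E_i satisfies [e_1, e_i] = e_(i+1) for i > 1. *)
Definition weight i : K := if (i <= 1)%N then 1 else 6 * (i - 2)`!%:R.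

Lemma weight_neq0 i : weight i != 0.
Proof.
rewrite /weight; case: ifP => _; first exact: oner_neq0.
by rewrite mulf_neq0 ?natr_neq0 ?fact_gt0.
Qed.

Lemma weightS i : (1 < i)%N -> weight i.+1 = (i%:R - 1) * weight i.
Proof.
case: i => [|[|i]] // _; rewrite /weight /= !subSS !subn0 factS natrM.
by rewrite -natr1; ring.
Qed.

Definition witt i j : K := (j%:R - i%:R) * weight i * weight j / weight (i + j)%N.

Lemma wittC i j : witt j i = - witt i j.
Proof. by rewrite /witt addnC; ring. Qed.

Lemma wittii i : witt i i = 0.
Proof. by rewrite /witt subrr !mul0r. Qed.

Lemma witt1 j : (1 < j)%N -> witt 1 j = 1.
Proof.
move=> j1; rewrite /witt (_ : weight 1 = 1) // add1n weightS // mulr1 mulfV //.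
by rewrite mulf_neq0 ?weight_neq0 // -natrB ?(ltnW j1) // natr_neq0 ?subn_gt0.
Qed.

(** The weights factor out of each term, which leaves the Jacobi identity for
    (j - i) E_(i+j). *)
Lemma witt_jacobi i j k :
  witt i (j + k)%N * witt j k + witt j (k + i)%N * witt k i
    + witt k (i + j)%N * witt i j = 0.
Proof.
have wE x y z : witt x (y + z)%N * witt y z =
    (y%:R + z%:R - x%:R) * (z%:R - y%:R) * (weight x * weight y * weight z)
    / weight (x + y + z)%N.
  rewrite /witt (addnA x) natrD; field.
  by rewrite !weight_neq0.
have jki : (j + k + i = i + j + k)%N by lia.
have kij : (k + i + j = i + j + k)%N by lia.
by rewrite !wE jki kij; ring.
Qed.

(** The main family of parameters: alpha_(k, 2k+1). *)
Definition alpha_diag k : K := 3 / ('C(k, 2)%:R * 'C(2 * k - 1, k - 1)%:R).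

Lemma alpha_diagE k : (1 < k)%N -> alpha_diag k = witt k k.+1.
Proof.
case: k => [|[|k]] // _; rewrite /alpha_diag /witt /weight /=.
have -> : (k.+2 - 1 = k.+1)%N by lia.
have -> : (2 * k.+2 - 1 = (2 * k).+3)%N by lia.
have -> : (k.+2 + k.+3 = (2 * k).+3.+2)%N by lia.
rewrite !subSS !subn0.
have bin2K : 'C(k.+2, 2)%:R = k.+2%:R * k.+1%:R / 2 :> K.
  apply: (mulIf (natr_neq0 (isT : 0 < 2)%N)); rewrite divfK ?natr_neq0 //.
  by rewrite -!natrM -[(_ * 2)%N]/(_ * 2`!)%N bin_ffact !ffactnS ffactn0 muln1.
have binK : 'C((2 * k).+3, k.+1)%:R
    = (2 * k).+3`!%:R / ((k.+2)%:R * (k.+1%:R * k`!%:R) * k.+1`!%:R) :> K.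
  rewrite -!natrM -!factS -(bin_fact (_ : k.+1 <= (2 * k).+3)%N); last by lia.
  rewrite (_ : (2 * k).+3 - k.+1 = k.+2)%N; last by lia.
  by rewrite [(_`! * _)%N]mulnC natrM mulfK // natr_neq0 ?muln_gt0 ?fact_gt0.
rewrite bin2K binK -[k.+3%:R]natr1; field.
by rewrite nat1r -[2 + k%:R]natrD !natr_neq0 ?fact_gt0.
Qed.

Lemma witt_step i j : (1 < i)%N -> (1 < j)%N ->
  witt i j.+1 = witt i j - witt i.+1 j.
Proof.
move=> i1 j1; have ij1 : (1 < i + j)%N by lia.
rewrite /witt addSn addnS !weightS // -![_.+1%:R]natr1 natrD; field.
rewrite weight_neq0 /= -natrD -(natrB _ (ltnW ij1)) natr_neq0 //; lia.
Qed.

(** Both sides satisfy the same recurrence and agree on the first two rows. *)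
Lemma tab_alpha_diag d i : (1 < i)%N -> tab alpha_diag d i = witt i (i + d)%N.
Proof.
elim/ltn_ind: d i => -[|[|d]] IH i i1; first by rewrite addn0 wittii.
  by rewrite addn1 -alpha_diagE.
rewrite tabSS !IH //; last by apply: ltnW.
rewrite addSnnS (addnS i d.+1) witt_step //; lia.
Qed.

(** For a small first index the factorials cancel to a rational function of the
    second one.  These values turn the Jacobi identities in positive order into
    identities that [field] decides. *)
Lemma witt_low s : (1 < s)%N ->
  [/\ witt 2 s = 6 * (s%:R - 2) / (s%:R * (s%:R - 1)),
      witt 3 s = 6 * (s%:R - 3) / ((s%:R + 1) * s%:R * (s%:R - 1))
    & witt 4 s = 12 * (s%:R - 4)
              / ((s%:R + 2) * (s%:R + 1) * s%:R * (s%:R - 1))].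
Proof.
move=> s1.
have s_neq0 c : s%:R + c%:R != 0 :> K.
  by rewrite -natrD natr_neq0 // addn_gt0 (ltnW s1).
have := s_neq0 0; rewrite addr0 => s0; have s10 : s%:R - 1 != 0 :> K.
  by rewrite -(natrB _ (ltnW s1)) natr_neq0 ?subn_gt0.
have [s11 s2] := (s_neq0 1%N, s_neq0 2%N).
have wD : weight (2 + s) = s%:R * (s%:R - 1) * weight s.
  by rewrite !add2n !weightS ?ltnS ?(ltnW s1) // -natr1; ring.
have wD3 : weight (3 + s) = (s%:R + 1) * weight (2 + s).
  by rewrite weightS // -[s.+2%:R]natr1 -natr1; ring.
have wD4 : weight (4 + s) = (s%:R + 2) * weight (3 + s).
  by rewrite weightS // -[s.+3%:R]natr1 -[s.+2%:R]natr1 -natr1; ring.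
rewrite /witt wD4 wD3 wD.
have -> : weight 4 = 12 by rewrite /weight /= -natrM.
have [-> ->] : weight 3 = 6 /\ weight 2 = 6 by rewrite /weight /= mulr1.
by split; field; rewrite weight_neq0 ?s0 ?s10 ?s11 ?s2.
Qed.

Lemma witt2 s : (1 < s)%N -> witt 2 s = 6 * (s%:R - 2) / (s%:R * (s%:R - 1)).
Proof. by case/witt_low. Qed.

Lemma witt3 s : (1 < s)%N ->
  witt 3 s = 6 * (s%:R - 3) / ((s%:R + 1) * s%:R * (s%:R - 1)).
Proof. by case/witt_low. Qed.

Lemma witt4 s : (1 < s)%N ->
  witt 4 s = 12 * (s%:R - 4) / ((s%:R + 2) * (s%:R + 1) * s%:R * (s%:R - 1)).
Proof. by case/witt_low. Qed.

End WittConstants.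

(** * The bracket as a deformation of the Witt bracket *)

(** The Leibniz defect is bilinear, hence determined on a spanning family. *)
Lemma derivation_on_generators (K : fieldType) (V : vectType K)
    (br : {bilinear V -> V -> V}) (I : eqType) (r : seq I) (e : I -> V)
    (c : I -> V -> K) (D : 'End(V)) :
  (forall x, x = \sum_(i <- r) c i x *: e i) ->
  {in r &, forall i j,
    D (br (e i) (e j)) = br (D (e i)) (e j) + br (e i) (D (e j))} ->
  derivation br D.
Proof.
move=> xE Der.
have DeR i y : i \in r -> D (br (e i) y) = br (D (e i)) y + br (e i) (D y).
  move=> ri; rewrite (xE y) !linear_sum /= -big_split !big_seq.
  apply: eq_bigr => j rj /=.
  by rewrite !linearZ_LR /= Der // scalerDr.
move=> x y; rewrite (xE x) linear_sumlz !linear_sum !linear_sumlz /=.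
rewrite -big_split !big_seq; apply: eq_bigr => i ri /=.
by rewrite linearZ /= !linearZl_LR linearZ /= DeR // scalerDr.
Qed.

Section FiliformAlgebra.

Variables (K : fieldType) (n : nat).
Hypotheses (charK0 : [pchar K] =i pred0) (le13n : (13 <= n)%N).
Implicit Types (i j k l r s t : nat) (D E : 'End('rV[K]_n)).

Local Notation m := (n - 11)%N.
Local Notation e := (bv K n).
Local Notation br := (fbr K n).
Local Notation W := (witt K).
Local Notation natr_neq0 := (natr_neq0 charK0).
Local Notation p := (alpha4n2 K n).
Local Notation q := (alpha5n K n).

(** The parameters of order one: alpha_(k, 2k+1+m) for k = 3, 4, 5. *)
Definition alpha_fst k : K :=
  if k == 3%N then 1 else if k == 4%N then alpha4n2 K n
  else if k == 5%N then alpha5n K n else 0.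

(** The parameter of order two: alpha_(4, 13) lies on the line s = 2 k + 1 + 2 m
    exactly because m = 2 when n = 13. *)
Definition alpha_snd k : K :=
  if (n == 13)%N && (k == 4)%N then alpha4n_13 K else 0.

Lemma alphaE k s : (1 < k)%N -> (s <= n)%N ->
  alpha K n k s = (s == 2 * k + 1)%N%:R * alpha_diag K k
    + (s == 2 * k + 1 + m)%N%:R * alpha_fst k
    + (s == 2 * k + 1 + 2 * m)%N%:R * alpha_snd k.
Proof.
move=> k1 le_sn; rewrite /alpha /alpha_fst /alpha_snd k1 /=.
have [sE|s_ne] := eqVneq s (2 * k + 1)%N.
  rewrite (_ : k <= n.-1./2)%N /=; last by lia.
  rewrite (_ : s == _ + m = false)%N; last by apply/eqP; lia.
  rewrite (_ : s == _ + 2 * m = false)%N; last by apply/eqP; lia.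
  by rewrite mul1r !mul0r !addr0.
rewrite andbF mul0r add0r.
have [->|k3] := eqVneq k 3%N.
  rewrite (_ : (2 * 3 + 1 + m = n - 4)%N); last by lia.
  by rewrite andbF mulr0 addr0 /= mulr1; case: ifP.
have [->|k4] := eqVneq k 4%N.
  rewrite (_ : (2 * 4 + 1 + m = n - 2)%N) /=; last by lia.
  have [->|_] := eqVneq s (n - 2)%N.
    rewrite (_ : _ == _ = false)%N ?mul0r ?mul1r ?addr0 //; apply/eqP; lia.
  rewrite mul0r add0r; have [n13|n13] := eqVneq n 13%N.
    rewrite (_ : (2 * 4 + 1 + 2 * m = n)%N) /=; last by lia.
    by case: eqP; rewrite ?mul1r ?mul0r.
  by rewrite mulr0 if_same.
have [->|k5] := eqVneq k 5%N; last by rewrite !andbF !mulr0 addr0.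
rewrite andbF mulr0 addr0 (_ : (2 * 5 + 1 + m = n)%N) /=; last by lia.
by case: eqP; rewrite ?mul1r ?mul0r.
Qed.

(** In the l-th term of the defining sum, the second index of alpha is
    2 (i + l) + 1 + (r - i - j).  So r - i - j selects one of the three
    families, and the sum over l becomes an entry of its difference table. *)
Lemma strcE i j r : (1 < i < j)%N -> (r <= n)%N ->
  strc K n i j r = (r == i + j)%N%:R * witt K i j
    + (r == i + j + m)%N%:R * alt alpha_fst i j
    + (r == i + j + 2 * m)%N%:R * alt alpha_snd i j.
Proof.
move=> ij le_rn; rewrite /strc !alt_lt //.
rewrite (_ : witt K i j = tab (alpha_diag K) (j - i) i); last first.
  by rewrite tab_alpha_diag ?subnKC //; lia.
rewrite !tab_sum_half; try lia.
rewrite !mulr_sumr -!big_split /=; apply: eq_big_nat => l lt_l.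
rewrite alphaE; [|lia|lia].
have -> : (r + i + 2 * l + 1 - j == 2 * (i + l) + 1)%N = (r == i + j)%N by lia.
have -> : (r + i + 2 * l + 1 - j == 2 * (i + l) + 1 + m)%N
          = (r == i + j + m)%N by lia.
have -> : (r + i + 2 * l + 1 - j == 2 * (i + l) + 1 + 2 * m)%N
          = (r == i + j + 2 * m)%N by lia.
by ring.
Qed.

Lemma bv_out i : (n < i)%N -> e i = 0.
Proof.
move=> lt_ni; apply/rowP => k; rewrite !mxE.
by have := ltn_ord k; case: eqP => //; lia.
Qed.

Lemma sum_delta_bv (c : K) s : (0 < s)%N ->
  \sum_(1 <= r < n.+1) ((r == s)%N%:R * c) *: e r = c *: e s.
Proof.
move=> s0; case: (leqP s n) => [le_sn|lt_ns].
  rewrite (bigD1_seq s) ?iota_uniq ?mem_index_iota ?s0 //= eqxx mul1r.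
  by rewrite big1 ?addr0 // => r /negPf->; rewrite mul0r scale0r.
rewrite bv_out // scaler0 big_nat big1 // => r lt_r.
by rewrite (_ : r == s = false) ?mul0r ?scale0r //; lia.
Qed.

Lemma brbC i j : brb K n j i = - brb K n i j.
Proof. by rewrite /brb; case: ltngtP; rewrite ?opprK ?oppr0. Qed.

Lemma fbrC x y : br y x = - br x y.
Proof.
rewrite /fbr -sumrN exchange_big /=; apply: eq_bigr => i _.
rewrite -sumrN; apply: eq_bigr => j _.
by rewrite brbC scalerN mulrC.
Qed.

Lemma fbr0 x : br x 0 = 0.
Proof. exact: linear0r. Qed.

Lemma fbr_bv0 x i : (n < i)%N -> br x (e i) = 0.
Proof. by move=> /bv_out->; rewrite linear0r. Qed.

(** Terms whose index exceeds n are zero vectors, so that the formula has one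
    shape for all i and j. *)
Lemma fbr_bvE i j : (0 < i)%N -> (0 < j)%N ->
  br (e i) (e j) = witt K i j *: e (i + j)%N
    + alt alpha_fst i j *: e (i + j + m)%N
    + alt alpha_snd i j *: e (i + j + 2 * m)%N.
Proof.
wlog lt_ij : i j / (i < j)%N => [Hwlog|] i0 j0.
  have [lt|lt|->] := ltngtP i j; first exact: Hwlog.
    rewrite fbrC Hwlog // wittC !(alt_anti _ i j) (addnC j).
    by rewrite !scaleNr -!opprD opprK.
  have -> : br (e j) (e j) = 0.
    have [le_jn|/fbr_bv0-> //] := leqP j n.
    by rewrite fbr_bv ?j0 // /brb ltnn.
  by rewrite wittii !altii !scale0r !addr0.
have [le_jn|lt_nj] := leqP j n; last first.
  by rewrite fbr_bv0 // !bv_out ?scaler0 ?addr0 //; lia.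
rewrite fbr_bv; [|lia|lia]; rewrite /brb lt_ij /brb_lt.
have [i1|i1] := eqVneq i 1%N.
  rewrite {i lt_ij i0}i1 in lt_ij *.
  rewrite witt1 // !alt1 !scale0r !addr0 scale1r add1n.
  by case: ltnP => // le_nj; rewrite bv_out.
rewrite -!sum_delta_bv -?big_split /=; try lia.
apply: eq_big_nat => r lt_r; rewrite strcE; try lia.
by rewrite !scalerDl.
Qed.

Local Notation A := (alt alpha_fst).
Local Notation B := (alt alpha_snd).

(** * The Jacobi identity *)

(** The coefficient of e_(i+j+k+t m) in [e_i, [e_j, e_k]]. *)
Definition nested t i j k : K :=
  match t with
  | 0 => W i (j + k)%N * W j k
  | 1 => W i (j + k + m)%N * A j k + A i (j + k) * W j k
  | 2 => W i (j + k + 2 * m)%N * B j k + A i (j + k + m) * A j k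
         + B i (j + k) * W j k
  | 3 => A i (j + k + 2 * m) * B j k + B i (j + k + m) * A j k
  | _ => B i (j + k + 2 * m) * B j k
  end.

Lemma fbr_nested i j k : (0 < i)%N -> (0 < j)%N -> (0 < k)%N ->
  br (e i) (br (e j) (e k)) =
    \sum_(t < 5) nested t i j k *: e (i + j + k + t * m)%N.
Proof.
move=> i0 j0 k0; rewrite fbr_bvE // !linearDr !linearZr_LR /= !fbr_bvE //;
  try lia.
rewrite !big_ord_recr big_ord0 /= add0r !addnA mul0n !addn0.
by apply/rowP => c; rewrite !mxE; ring.
Qed.

Lemma nested_jacobi_order0 i j k :
  nested 0 i j k + nested 0 j k i + nested 0 k i j = 0.
Proof. exact: witt_jacobi. Qed.

(** A and B vanish as soon as one index is 1, so that the products of two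
    corrections drop out and only the recurrence of the tables remains. *)
Lemma nested_jacobi_e1 t j k : (1 < j)%N -> (1 < k)%N ->
  nested t 1 j k + nested t j k 1 + nested t k 1 j = 0.
Proof.
move=> j1 k1; have w1 s : W 1 (j + k + s) = 1 by rewrite witt1 //; lia.
have w1j : W 1 j = 1 by rewrite witt1.
have wk1 : W k 1 = -1 by rewrite wittC witt1.
have step a : alt a j k = alt a j k.+1 - alt a k j.+1.
  by rewrite -(alt_step a j1 k1) -alt_anti addrC.
case: t => [|[|[|[|t]]]]; first exact: nested_jacobi_order0.
all: rewrite /= ?w1 ?w1j ?wk1 !alt1 ![alt _ _ 1]alt_anti !alt1.
all: rewrite ?addn1 ?add1n ?step.
all: ring.
Qed.

(** The entries of the order-one table at the pairs that occur in the identities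
    for index sums up to 11 and in the relation for [e_2, e_5]. *)
Lemma alt_fst_values :
  (A 2 3 = 0) * (A 2 4 = 0) * (A 3 4 = 1) * (A 4 5 = p) * (A 5 6 = q)
  * (A 2 5 = -1) * (A 3 5 = 1) * (A 2 6 = - 2) * (A 3 6 = 1 - p)
  * (A 4 7 = p - q) * (A 2 7 = p - 3) * (A 3 7 = 1 - 2 * p)
  * (A 2 8 = 3 * p - 4) * (A 3 8 = 1 - 3 * p + q) * (A 2 9 = 6 * p - q - 5).
Proof. by do !split; rewrite alt_lt //= /alpha_fst /=; ring. Qed.

Local Notation alt_fstE := (alt_fst_values, (alt_anti alpha_fst 2 4,
  alt_anti alpha_fst 2 5, alt_anti alpha_fst 2 6,
  alt_anti alpha_fst 5 6)).

(** Evaluates the index sums of a concrete triple while leaving sums with m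
    untouched, which simplification would unfold into successors. *)
Lemma small_sums : ((3 + 4 = 7)%N * (4 + 2 = 6)%N * (2 + 3 = 5)%N
  * (3 + 5 = 8)%N * (5 + 2 = 7)%N * (3 + 6 = 9)%N * (6 + 2 = 8)%N
  * (4 + 5 = 9)%N * (2 + 4 = 6)%N)%type.
Proof. by []. Qed.

(** Only (2,3,4), (2,3,5), (2,3,6) and (2,4,5) have i + j + k + m <= n.  The
    first of them determines alpha_(4, n-2) from alpha_(3, n-4) = 1, and those
    with sum 11 then determine alpha_(5, n). *)
Lemma nested_jacobi_order1 i j k : (1 < i < j)%N -> (j < k)%N ->
  (i + j + k + m <= n)%N -> nested 1 i j k + nested 1 j k i + nested 1 k i j = 0.
Proof.
move=> ij jk le_n.
have Nge c : (c < 13)%N -> n%:R - c%:R != 0 :> K.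
  by move=> lt_c; rewrite -natrB ?natr_neq0 //; lia.
have mE s : (s + m)%:R = n%:R + s%:R - 11 :> K.
  by rewrite natrD natrB; [ring|lia].
have cases : [\/ [/\ i = 2, j = 3 & k = 4], [/\ i = 2, j = 3 & k = 5],
    [/\ i = 2, j = 3 & k = 6] | [/\ i = 2, j = 4 & k = 5]]%N.
  have : (i + j + k <= 11)%N by lia.
  case: (eqVneq j 3%N) => j3; last by move=> le11; apply: Or44; split; lia.
  have : (k = 4 \/ k = 5 \/ k = 6)%N by lia.
  by move=> [|[|]] -> _; [apply: Or41|apply: Or42|apply: Or43]; split; lia.
have [[-> -> ->]|[-> -> ->]|[-> -> ->]|[-> -> ->]] := cases;
  rewrite /nested !(small_sums, alt_fstE) ?altii ?[W 5 2]wittC ?[W 6 2]wittC;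
  rewrite !(witt2 charK0) ?(witt3 charK0) ?(witt4 charK0) //; try lia;
  rewrite ?mE /alpha4n2 /alpha5n /=; field;
  do ?[apply/andP; split]; try exact: natr_neq0.
all: try exact: Nge.
- by have -> : n%:R + 5 - 11 - 1 = n%:R - 7 :> K; [ring|exact: Nge].
- by have -> : n%:R + 5 - 11 = n%:R - 6 :> K; [ring|exact: Nge].
- by have -> : n%:R + 7 - 11 + 1 = n%:R - 3 :> K; [ring|exact: Nge].
Qed.

(** Since i + j + k >= 9, the bound leaves n = 13 and the triple (2,3,4), where
    the identity is the equation solved by alpha_(4, 13). *)
Lemma nested_jacobi_order2 i j k : (1 < i < j)%N -> (j < k)%N ->
  (i + j + k + 2 * m <= n)%N ->
  nested 2 i j k + nested 2 j k i + nested 2 k i j = 0.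
Proof.
move=> ij jk le_n.
have [n13 iE jE kE] : [/\ n = 13, i = 2, j = 3 & k = 4]%N by split; lia.
have m2 : (m = 2)%N by rewrite n13.
have BE : (B 2 3 = 0) * (B 3 4 = 0) * (B 4 2 = 0) * (B 4 5 = alpha4n_13 K)
    * (B 3 6 = - alpha4n_13 K) * (B 2 7 = alpha4n_13 K).
  rewrite (alt_anti _ 2 4); do !split; rewrite alt_lt //= /alpha_snd n13 /=; ring.
rewrite iE jE kE /nested m2 !(small_sums, BE) -[(7 + 2)%N]/9%N !alt_fstE.
rewrite (witt3 charK0) // (witt4 charK0) // !(witt2 charK0) //.
have NE : (13%:R - 2 = 11 :> K) * (13%:R - 3 = 10 :> K) * (13%:R - 4 = 9 :> K)
    * (13%:R - 5 = 8 :> K) * (13%:R - 6 = 7 :> K) * (13%:R - 7 = 6 :> K)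
    * (13%:R - 8 = 5 :> K) by do !split; ring.
(* Split into small factors, denominators stay small in the side conditions of
   [field], which are stated with unary numerals. *)
have DE : 15 * 10 ^+ 3 + 246 = 126 * 121 :> K by ring.
rewrite /alpha4n2 /alpha5n /alpha4n_13 n13 !NE DE !invfM; field.
by rewrite oner_neq0 !natr_neq0.
Qed.

(** For t >= 3 there is nothing left: i + j + k >= 9 when i > 1, while
    n - 3 m = 33 - 2 n <= 7. *)
Lemma nested_jacobi t i j k : (t < 5)%N -> (0 < i < j)%N -> (j < k)%N ->
  (i + j + k + t * m <= n)%N ->
  nested t i j k + nested t j k i + nested t k i j = 0.
Proof.
move=> lt_t ij jk le_n; have [i1|i1] := leqP i 1.
  by rewrite (_ : i = 1%N); [apply: nested_jacobi_e1; lia|lia].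
case: t lt_t le_n => [|[|[|t]]] lt_t le_n.
- exact: nested_jacobi_order0.
- by apply: nested_jacobi_order1; lia.
- by apply: nested_jacobi_order2; lia.
- have : (3 * m <= t.+3 * m)%N by rewrite leq_mul2r; lia.
  lia.
Qed.

Definition jacobiator x y z := br x (br y z) + br y (br z x) + br z (br x y).

Lemma jacobiator_rot x y z : jacobiator y z x = jacobiator x y z.
Proof. by rewrite /jacobiator addrC addrA. Qed.

Lemma jacobiator_swap x y z : jacobiator y x z = - jacobiator x y z.
Proof.
rewrite /jacobiator (fbrC z x) (fbrC y z) (fbrC x y) !linearNr /=.
by rewrite -!opprD [in LHS](addrC (br y _)).
Qed.

Lemma fbr_bvv i : br (e i) (e i) = 0.
Proof.
have [le_in|lt_ni] := leqP i n; last by rewrite fbr_bv0.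
case: i le_in => [|i] le_in; last by rewrite fbr_bv // /brb ltnn.
by rewrite (_ : e 0 = 0) ?fbr0 //; apply/rowP => c; rewrite !mxE.
Qed.

Lemma jacobiator_bvv i z : jacobiator (e i) (e i) z = 0.
Proof. by rewrite /jacobiator fbr_bvv (fbrC z) linearNr fbr0 /= addr0 addNr. Qed.

Lemma jacobiator_sorted i j k : (0 < i < j)%N -> (j < k)%N ->
  jacobiator (e i) (e j) (e k) = 0.
Proof.
move=> ij jk; rewrite /jacobiator !fbr_nested; try lia.
have [-> ->] : (j + k + i = i + j + k /\ k + i + j = i + j + k)%N by lia.
rewrite -!big_split big1 // => t _ /=; rewrite -!scalerDl.
have [le_n|lt_n] := leqP (i + j + k + t * m) n.
  by rewrite nested_jacobi // scale0r.
by rewrite bv_out // scaler0.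
Qed.

(** The jacobiator is alternating, which reduces it to increasing indices. *)
Lemma jacobiator_bv i j k : (0 < i)%N -> (0 < j)%N -> (0 < k)%N ->
  jacobiator (e i) (e j) (e k) = 0.
Proof.
wlog lt_ij : i j k / (i < j)%N => [Hw|] i0 j0 k0.
  have [lt|lt|->] := ltngtP i j; [exact: Hw| |exact: jacobiator_bvv].
  by rewrite jacobiator_swap Hw ?oppr0.
have [lt_jk|lt_kj|<-] := ltngtP j k.
- by rewrite jacobiator_sorted ?i0.
- have [lt_ik|lt_ki|<-] := ltngtP i k.
  + by rewrite -jacobiator_rot jacobiator_swap -jacobiator_rot -jacobiator_rot
      jacobiator_sorted ?i0 ?oppr0.
  + by rewrite -jacobiator_rot -jacobiator_rot jacobiator_sorted ?k0.
  + by rewrite -jacobiator_rot -jacobiator_rot jacobiator_bvv.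
- by rewrite -jacobiator_rot jacobiator_bvv.
Qed.

Lemma derivation_ad i : (0 < i)%N -> derivation br (ad br (e i)).
Proof.
move=> i0; apply: (derivation_on_generators (@row_co K n)) => j k.
rewrite !mem_index_iota !adE => /andP[j0 _] /andP[k0 _].
have /eqP := jacobiator_bv i0 j0 k0; rewrite /jacobiator.
rewrite [br (e k) (br _ _)]fbrC [br (e k) (e i)]fbrC linearNr -addrA -opprD.
by rewrite subr_eq0 addrC => /eqP.
Qed.

(** * Normalised derivations *)

Lemma co_bv_neq s i : s != i -> co s (e i) = 0.
Proof.
move=> ne_si; rewrite /co big1 // => k /eqP ks.
by rewrite mxE ks (negPf ne_si).
Qed.

Lemma co_bv1 i : (0 < i <= n)%N -> co i (e i) = 1.
Proof. by move=> i_n; rewrite co_bv // eqxx. Qed.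

Lemma co_inj (x y : 'rV[K]_n) :
  (forall s, (0 < s <= n)%N -> co s x = co s y) -> x = y.
Proof.
move=> xy; rewrite (row_co x) (row_co y) !big_nat.
by apply: eq_bigr => s s_n; rewrite xy.
Qed.

Lemma lfun_bv_eq0 (D : 'End('rV[K]_n)) :
  (forall i, (0 < i)%N -> D (e i) = 0) -> D = 0.
Proof.
move=> D0; apply/lfunP => x; rewrite zero_lfunE (row_co x) linear_sum big_nat.
by rewrite big1 // => i /andP[i0 _]; rewrite linearZ /= D0 // scaler0.
Qed.

Lemma co_fbr_low i j s : (0 < i)%N -> (0 < j)%N -> (s < i + j)%N ->
  co s (br (e i) (e j)) = 0.
Proof.
move=> i0 j0 lt_s; rewrite fbr_bvE // !linearD !linearZ /=.
by rewrite !co_bv_neq ?mulr0 ?addr0 //; lia.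
Qed.

Lemma co_fbr_lead i j : (0 < i)%N -> (0 < j)%N -> (i + j <= n)%N ->
  co (i + j) (br (e i) (e j)) = W i j.
Proof.
move=> i0 j0 le_n; rewrite fbr_bvE // !linearD !linearZ /=.
rewrite co_bv1 ?mulr1 ?addn_gt0 ?i0 //.
by rewrite !co_bv_neq ?mulr0 ?addr0 //; lia.
Qed.

Lemma fbr_e1 i : (1 < i)%N -> br (e 1) (e i) = e i.+1.
Proof.
move=> i1; rewrite fbr_bvE ?(ltnW i1) // witt1 // !alt1 !scale0r !addr0.
exact: scale1r.
Qed.

Lemma fbr_e2e3 : br (e 2) (e 3) = e 5.
Proof.
rewrite fbr_bvE // alt_fst_values witt2 // alt_lt //=.
rewrite /alpha_snd andbF !scale0r !addr0.
rewrite (_ : _ / _ = 1) ?scale1r //; field.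
by rewrite !natr_neq0.
Qed.

Lemma fbr_e2e4 : br (e 2) (e 4) = e 6.
Proof.
rewrite fbr_bvE // alt_fst_values witt2 // alt_lt //=.
rewrite /alpha_snd !andbF subr0 !scale0r !addr0.
rewrite (_ : _ / _ = 1) ?scale1r //; field.
by rewrite !natr_neq0.
Qed.

Lemma fbr_e2e5 : br (e 2) (e 5) = W 2 5 *: e 7 - e (7 + m)%N.
Proof.
rewrite fbr_bvE // alt_fst_values [alt _ 2 5]alt_lt //=.
by rewrite /alpha_snd !andbF !subr0 scale0r addr0 scaleN1r.
Qed.

(** For x = D e_2, with D e_1 = 0, computing D e_5 through
    e_5 = [e_1, [e_1, [e_1, e_2]]] and through e_5 = [e_2, e_3] gives two values
    whose difference is the image of x under this map. *)
Definition obstruction : 'End('rV[K]_n) :=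
  (ad br (e 1) \o (ad br (e 1) \o ad br (e 1)))%VF + ad br (e 3)
  - (ad br (e 2) \o ad br (e 1))%VF.

Lemma obstructionE x : obstruction x =
  br (e 1) (br (e 1) (br (e 1) x)) + br (e 3) x - br (e 2) (br (e 1) x).
Proof. by rewrite /obstruction !(add_lfunE, opp_lfunE, comp_lfunE, adE). Qed.

Lemma obstruction_e1 : obstruction (e 1) = - e 4.
Proof.
by rewrite obstructionE fbr_bvv // !fbr0 subr0 add0r fbrC fbr_e1.
Qed.

Lemma obstruction_e2 : obstruction (e 2) = - e 5.
Proof.
rewrite obstructionE !fbr_e1 // fbr_e2e3 addrAC subrr add0r fbrC.
by rewrite fbr_e2e3.
Qed.

Lemma co_obstruction_low k s : (1 < k)%N -> (s < k + 3)%N ->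
  co s (obstruction (e k)) = 0.
Proof.
move=> k1 lt_s; rewrite obstructionE !fbr_e1; try lia.
rewrite linearB linearD /= !co_fbr_low ?co_bv_neq ?subr0 ?addr0 //; lia.
Qed.

(** The coordinate is 1 + W 3 k - W 2 (k + 1); its numerator factors as
    (k - 3) (k^2 - 3 k + 8), and the quadratic has no integer root. *)
Lemma co_obstruction_lead k : (3 < k)%N -> (k + 3 <= n)%N ->
  co (k + 3) (obstruction (e k)) != 0.
Proof.
move=> k3 le_n; rewrite obstructionE !fbr_e1; try lia.
rewrite linearB linearD /= {1}addn3 co_bv1; last by lia.
rewrite {1}addnC co_fbr_lead; try lia.
have -> : (k + 3 = 2 + k.+1)%N by lia.
rewrite co_fbr_lead; try lia.
rewrite (witt2 charK0) ?(witt3 charK0) -?natr1; try lia.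
have k_gt1 : (1 < k)%N by lia.
have k1 : k%:R - 1 != 0 :> K.
  by rewrite -(natrB _ (ltnW k_gt1)) natr_neq0 ?subn_gt0.
have k0 : k%:R != 0 :> K by rewrite natr_neq0 //; lia.
have k10 : k%:R + 1 != 0 :> K by rewrite natr1 natr_neq0.
rewrite (_ : _ - _ = (k - 3)%:R * (k * k + 8 - 3 * k)%:R
    / ((k%:R - 1) * k%:R * (k%:R + 1))).
  by rewrite !mulf_neq0 ?invr_neq0 ?mulf_neq0 ?natr_neq0 //; nia.
rewrite !natrB ?natrD ?natrM; [|nia|lia]; field.
by rewrite k1 k0 k10.
Qed.

(** Modulo the inner derivations and the t_i, every derivation satisfies the
    hypotheses of this section; the outcome is that it vanishes. *)
Section Normalised.

Variables (D : 'End('rV[K]_n)) (a b : K).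
Hypotheses (derD : derivation br D) (De1 : D (e 1) = a *: e 1 + b *: e 2).

Let x := D (e 2).

Lemma derivation_succ i : (1 < i)%N ->
  D (e i.+1) = a *: e i.+1 + b *: br (e 2) (e i) + br (e 1) (D (e i)).
Proof.
move=> i1; rewrite -{1}fbr_e1 // derD De1 linearDl !linearZl_LR /=.
by rewrite fbr_e1.
Qed.

Lemma obstruction_equation :
  obstruction x + (a *+ 2) *: e 5 + (b *+ 2) *: e 6 = 0.
Proof.
have De3 : D (e 3) = a *: e 3 + br (e 1) x.
  by rewrite derivation_succ // fbr_bvv // scaler0 addr0.
have De4 : D (e 4) = a *: e 4 + b *: e 5 + br (e 1) (D (e 3)).
  by rewrite derivation_succ // fbr_e2e3.
have De5 : D (e 5) = a *: e 5 + b *: e 6 + br (e 1) (D (e 4)).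
  by rewrite derivation_succ // fbr_e2e4.
have := derD (e 2) (e 3); rewrite fbr_e2e3 De5 De4 De3.
rewrite !linearDr !linearZr_LR /= !fbr_e1 // fbr_e2e3.
rewrite (fbrC (e 3)) obstructionE -/x => /eqP; rewrite -subr_eq0 => /eqP <-.
apply/rowP => c; rewrite !mxE; ring.
Qed.

(** The map [obstruction] sends e_l to a combination of e_s with s >= l + 3, and
    on e_1, e_2 it has that leading term only.  So in the coordinate k + 3 of
    [obstruction_equation] only the k-th coordinate of x is left, once the lower
    ones from the third on are 0. *)
Lemma obstruction_coord k : (0 < k)%N -> (k + 3 <= n)%N ->
  (forall l, (2 < l < k)%N -> co l x = 0) ->
  co k x * co (k + 3) (obstruction (e k))
    + (a *+ 2) *+ (k == 2%N) + (b *+ 2) *+ (k == 3%N) = 0.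
Proof.
move=> k0 le_n x0.
have /(congr1 (co (k + 3)%N)) := obstruction_equation.
rewrite [X in obstruction X]row_co linear_sum !linearD !linearZ linear_sum /=.
rewrite linear0.
rewrite (bigD1_seq k) ?iota_uniq ?mem_index_iota ?k0 //=; last by lia.
rewrite big_seq_cond big1 => [|l]; last first.
  rewrite mem_index_iota => /andP[l_n ne_lk].
  rewrite linearZ linearZ /=.
  have [lt_l|le_l] := ltnP l k; last first.
    by rewrite co_obstruction_low ?mulr0 //; lia.
  have [->|l1] := eqVneq l 1%N.
    by rewrite obstruction_e1 linearN /= co_bv_neq ?oppr0 ?mulr0 //; lia.
  have [->|l2] := eqVneq l 2%N.
    by rewrite obstruction_e2 linearN /= co_bv_neq ?oppr0 ?mulr0 //; lia.
  by rewrite x0 ?mul0r //; lia.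
rewrite linearZ linearZ /= addr0 => <-; congr (_ + _ + _).
  have [->|k2] := eqVneq k 2%N; first by rewrite co_bv1 ?mulr1 //; lia.
  by rewrite co_bv_neq ?mulr0 //; lia.
have [->|k3] := eqVneq k 3%N; first by rewrite co_bv1 ?mulr1 //; lia.
by rewrite co_bv_neq ?mulr0 //; lia.
Qed.

Hypothesis x3 : co 3 x = 0.

Lemma normalised_high k : (2 < k)%N -> (k + 3 <= n)%N -> co k x = 0.
Proof.
elim/ltn_ind: k => k IH k2 le_n; have [->//|k3] := eqVneq k 3%N.
have := @obstruction_coord k (ltnW (ltnW k2)) le_n.
rewrite (negPf k3) (_ : k == 2 = false)%N ?addr0; last by lia.
move=> /(_ _)/eqP; rewrite mulf_eq0 (negPf (co_obstruction_lead _ _)) ?orbF //;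
  last by lia.
by move=> -/(_ _)/eqP; apply=> l /andP[l2 lt_lk]; apply: IH => //; lia.
Qed.

Hypothesis x_top : forall k, (n < k + 3)%N -> co k x = 0.

(** The coordinates 4, 5 and 6 of [obstruction_equation] give the first
    coordinate of x, its second coordinate, and b. *)
Lemma normalised_De2 : b = 0 /\ x = (a *+ 2) *: e 2.
Proof.
have obs k : (0 < k <= 3)%N -> co k x * co (k + 3) (obstruction (e k))
    + (a *+ 2) *+ (k == 2%N) + (b *+ 2) *+ (k == 3%N) = 0.
  by move=> k3; apply: obstruction_coord => [||l]; lia.
have x1 : co 1 x = 0.
  have := obs 1%N isT; rewrite obstruction_e1 linearN /=.
  rewrite co_bv1 /= ?addr0; last lia.
  by rewrite mulrN1 => /eqP; rewrite oppr_eq0 => /eqP.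
have x2 : co 2 x = a *+ 2.
  have := obs 2%N isT; rewrite obstruction_e2 linearN /=.
  rewrite co_bv1 /= ?addr0; last lia.
  by rewrite mulrN1 addrC => /eqP; rewrite subr_eq0 => /eqP.
have /eqP := obs 3%N isT; rewrite x3 mul0r !add0r mulr1n -mulr_natr mulf_eq0.
rewrite (negPf (natr_neq0 _)) // orbF => /eqP b0; split=> //.
apply: co_inj => s s_n; rewrite linearZ /=.
have [->|s2] := eqVneq s 2%N; first by rewrite x2 co_bv1 ?mulr1 //; lia.
rewrite co_bv_neq // mulr0; have [->//|s1] := eqVneq s 1%N.
have [le_s|lt_s] := leqP (s + 3) n; last exact: x_top.
by apply: normalised_high; lia.
Qed.

(** D acts on e_i as i a, and [e_2, e_5] has components along both e_7 and
    e_(n-4): comparing the two gives (n - 11) a = 0. *)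
Lemma normalised_derivation_eq0 : D = 0.
Proof.
have [b0 xE] := normalised_De2.
have De i : (0 < i)%N -> D (e i) = (a *+ i) *: e i.
  elim: i => // i IH _; case: i IH => [|[|i]] IH.
  - by rewrite De1 b0 scale0r addr0.
  - exact: xE.
  rewrite derivation_succ // IH // linearZr_LR /= fbr_e1 // b0 scale0r addr0.
  by rewrite -scalerDl -mulrS.
apply: lfun_bv_eq0 => i i0; rewrite De //.
suff -> : a = 0 by rewrite mul0rn scale0r.
have := derD (e 2) (e 5).
rewrite !De // linearZl_LR linearZr_LR /= fbr_e2e5 linearB linearZ /= !De //.
rewrite -scalerDl -mulrnDr => /(congr1 (co (7 + m)%N)).
rewrite !(linearB, linearZ) /= co_bv_neq; last by lia.
rewrite co_bv1; last by lia.
rewrite !mulr0 !sub0r !mulr1 mulrN1 => /oppr_inj/eqP.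
rewrite -[(2 + 5)%N]/7%N mulrnDr -subr_eq0 addrAC subrr add0r -mulr_natr mulf_eq0.
have m0 : m%:R != 0 :> K by rewrite natr_neq0 //; lia.
by rewrite (negPf m0) orbF => /eqP.
Qed.

End Normalised.

(** * The basis of the derivation algebra *)

(** On the left the bracket is hidden in its bilinear structure; rewriting with
    lemmas on [fbr] needs it exposed. *)
Lemma ad_fbrE x y : ad br x y = br x y.
Proof. exact: adE. Qed.

(** For 2 <= i < j, the bracket [e_i, e_j] involves only e_s with s >= 5, which
    D kills, and [D e_i, e_j] only e_s with s >= i + j + h > n. *)
Lemma derivation_shift D h : (n <= h + 4)%N ->
  (forall i, (0 < i)%N -> D (e i) = if i == 1%N then 0 else e (i + h)) ->
  derivation br D.
Proof.
move=> le_h De.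
have D1 j : (0 < j)%N ->
    D (br (e 1) (e j)) = br (D (e 1)) (e j) + br (e 1) (D (e j)).
  move=> j0; rewrite !De // eqxx [br 0 _]fbrC fbr0 oppr0 add0r.
  have [->|j1] := eqVneq j 1%N; first by rewrite fbr0 fbr_bvv // linear0.
  rewrite !fbr_e1 ?De //; try lia.
  by case: eqP => //; lia.
suff Dij i j : (0 < i)%N -> (0 < j)%N ->
    D (br (e i) (e j)) = br (D (e i)) (e j) + br (e i) (D (e j)).
  apply: (derivation_on_generators (@row_co K n)) => i j.
  by rewrite !mem_index_iota => /andP[i0 _] /andP[j0 _]; apply: Dij.
move=> i0 j0; have [->|i1] := eqVneq i 1%N; first exact: D1.
have [->|j1] := eqVneq j 1%N.
  rewrite (fbrC (e 1) (e i)) (fbrC (e 1) (D (e i))) (fbrC (D (e 1))) linearN.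
  by rewrite /= D1 // -opprD addrC.
have [->|ne_ij] := eqVneq i j.
  by rewrite fbr_bvv // linear0 [X in _ = _ + X]fbrC addrN.
rewrite !De // (negPf i1) (negPf j1).
rewrite (fbr_bvE i0 j0) !linearD !linearZ /= !De; try lia.
rewrite !ifN; try lia.
rewrite !fbr_bvE //; try lia.
by rewrite !bv_out ?scaler0 ?addr0 //; lia.
Qed.

Lemma t1_bv i : (0 < i)%N ->
  t1 K n (e i) = if i == 1%N then 0 else e (i + (n - 2)).
Proof.
move=> i0; rewrite lfunE /= /t1_fun.
have [->|i1] := eqVneq i 1%N; first by rewrite co_bv_neq ?scale0r.
have [->|i2] := eqVneq i 2%N.
  by rewrite co_bv1 ?scale1r ?subnKC //; lia.
by rewrite co_bv_neq ?scale0r 1?eq_sym // bv_out //; lia.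
Qed.

Lemma t2_bv i : (0 < i)%N ->
  t2 K n (e i) = if i == 1%N then 0 else e (i + (n - 3)).
Proof.
move=> i0; rewrite lfunE /= /t2_fun.
have [->|i1] := eqVneq i 1%N; first by rewrite !co_bv_neq ?scale0r ?addr0.
have [->|i2] := eqVneq i 2%N.
  rewrite co_bv1 ?co_bv_neq ?scale1r ?scale0r ?addr0; try lia.
  by congr (e _); lia.
have [->|i3] := eqVneq i 3%N.
  by rewrite co_bv1 ?co_bv_neq ?scale1r ?scale0r ?add0r ?subnKC; try lia.
by rewrite !co_bv_neq ?scale0r 1?eq_sym // bv_out ?addr0 //; lia.
Qed.

Lemma t3_bv i : (0 < i)%N ->
  t3 K n (e i) = if i == 1%N then 0 else e (i + (n - 4)).
Proof.
move=> i0; rewrite lfunE /= /t3_fun.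
have [->|i1] := eqVneq i 1%N; first by rewrite !co_bv_neq ?scale0r ?addr0.
have [->|i2] := eqVneq i 2%N.
  rewrite co_bv1 ?co_bv_neq ?scale1r ?scale0r ?addr0; try lia.
  by congr (e _); lia.
have [->|i3] := eqVneq i 3%N.
  rewrite co_bv1 ?co_bv_neq ?scale1r ?scale0r ?addr0 ?add0r; try lia.
  by congr (e _); lia.
have [->|i4] := eqVneq i 4%N.
  by rewrite co_bv1 ?co_bv_neq ?scale1r ?scale0r ?add0r ?subnKC; try lia.
by rewrite !co_bv_neq ?scale0r 1?eq_sym // bv_out ?addr0 //; lia.
Qed.

Definition outer : seq 'End('rV[K]_n) := [:: t1 K n; t2 K n; t3 K n].

Lemma outer_bv E : E \in outer ->
  exists2 h, (n <= h + 4)%N &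
    forall i, (0 < i)%N -> E (e i) = if i == 1%N then 0 else e (i + h).
Proof.
rewrite !inE => /or3P[] /eqP->.
- by exists (n - 2)%N; [lia|exact: t1_bv].
- by exists (n - 3)%N; [lia|exact: t2_bv].
- by exists (n - 4)%N; [lia|exact: t3_bv].
Qed.

Definition der_basis : seq 'End('rV[K]_n) :=
  [seq ad br (e i) | i <- iota 1 (n - 1)] ++ outer.

Lemma der_basis_sub E : E \in der_basis -> E \in Der br.
Proof.
rewrite mem_cat => /orP[/mapP[i + ->]|/outer_bv[h le_h Ee]]; last first.
  by apply/memDer; apply: derivation_shift Ee.
rewrite mem_iota => /andP[i0 _]; apply/memDer; exact: derivation_ad.
Qed.

Lemma span_probe (X : seq 'End('rV[K]_n)) D s (x : 'rV[K]_n) : D \in <<X>>%VS ->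
  (forall E, E \in X -> co s (E x) = 0) -> co s (D x) = 0.
Proof.
move=> /(@coord_span _ _ _ (in_tuple X)) -> X0.
rewrite sum_lfunE linear_sum big1 // => i _.
by rewrite scale_lfunE linearZ /= X0 ?mulr0 // mem_nth.
Qed.

(** A coordinate of the image of some x separates D from the span of X. *)
Lemma free_cons_probe (X : seq 'End('rV[K]_n)) D s (x : 'rV[K]_n) :
  co s (D x) != 0 -> (forall E, E \in X -> co s (E x) = 0) -> free X ->
  free (D :: X).
Proof.
move=> Dx X0; rewrite free_cons => ->; rewrite andbT.
by apply: contra Dx => /span_probe/(_ X0)->.
Qed.

Lemma free_outer : free outer.
Proof.
have t_e2 h s : (h < n - 1)%N -> (s = 2 + h)%N -> co s (e (2 + h)) != 0.
  by move=> lt_h ->; rewrite co_bv1 ?oner_neq0 //; lia.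
apply: (@free_cons_probe _ _ n (e 2)).
- by rewrite t1_bv // t_e2; lia.
- move=> E; rewrite !inE => /orP[] /eqP->; rewrite ?t2_bv ?t3_bv //=.
    by rewrite co_bv_neq //; lia.
  by rewrite co_bv_neq //; lia.
apply: (@free_cons_probe _ _ (n - 1) (e 2)).
- by rewrite t2_bv // t_e2; lia.
- move=> E; rewrite !inE => /eqP->; rewrite t3_bv //=.
  by rewrite co_bv_neq //; lia.
rewrite seq1_free; apply/eqP => /lfunP/(_ (e 2)).
rewrite t3_bv // zero_lfunE => /(congr1 (co (2 + (n - 4)))).
by rewrite linear0; apply/eqP/t_e2; lia.
Qed.

(** In the order of the list, ad(e_1) is detected by the coordinate 3 on e_2,
    and ad(e_i) with i > 1 by the coordinate i + 1 on e_1; each of these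
    coordinates vanishes on the members that follow. *)
Lemma free_der_basis : free der_basis.
Proof.
suff freei c i : (0 < i)%N -> (i + c <= n)%N ->
    free ([seq ad br (e k) | k <- iota i c] ++ outer).
  by apply: freei; lia.
elim: c i => [|c IH] i i0 le_n; first exact: free_outer.
rewrite /=.
have [i1|i1] := eqVneq i 1%N; last first.
  apply: (@free_cons_probe _ _ i.+1 (e 1)); last by apply: IH; lia.
    rewrite ad_fbrE fbrC fbr_e1 ?linearN /= ?co_bv1 ?oppr_eq0 ?oner_neq0 //; lia.
  move=> E; rewrite mem_cat => /orP[/mapP[k]|/outer_bv[h _ ->]];
    rewrite ?linear0 //.
  rewrite mem_iota => lt_k ->; rewrite ad_fbrE fbrC fbr_e1 ?linearN /=; try lia.
  by rewrite co_bv_neq ?oppr0 //; lia.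
apply: (@free_cons_probe _ _ 3 (e 2)); last by apply: IH; lia.
  by rewrite i1 ad_fbrE fbr_e1 // co_bv1 ?oner_neq0 //; lia.
move=> E; rewrite mem_cat => /orP[/mapP[k]|/outer_bv[h le_h ->]] //.
  by rewrite mem_iota => lt_k ->; rewrite ad_fbrE co_fbr_low //; lia.
by rewrite co_bv_neq //=; lia.
Qed.

(** The coordinates of D e_1 of index > 2 are removed by the ad(e_i) with
    i > 1, then the third coordinate of D e_2 by ad(e_1), which kills e_1, and
    its last three coordinates by the t_i, which kill e_1 as well. *)
Lemma Der_sub_span D : D \in Der br -> D \in <<der_basis>>%VS.
Proof.
move=> DerD; set U := <<der_basis>>%VS.
have adU i : (0 < i < n)%N -> ad br (e i) \in U.
  move=> i_n; apply: memv_span; rewrite mem_cat; apply/orP; left.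
  by apply/mapP; exists i => //; rewrite mem_iota; lia.
have outU E : E \in outer -> E \in U.
  by move=> outE; apply: memv_span; rewrite mem_cat outE orbT.
have subU E : E \in U -> E \in Der br.
  by apply/subvP/span_subvP => F; apply: der_basis_sub.
pose F1 := \sum_(2 <= i < n) co i.+1 (D (e 1)) *: ad br (e i).
pose c3 := co 3 ((D + F1) (e 2)).
pose D2 := D + F1 - c3 *: ad br (e 1).
pose top s := co s (D2 (e 2)).
pose F3 := top n *: t1 K n + top (n - 1)%N *: t2 K n + top (n - 2)%N *: t3 K n.
have F1U : F1 \in U.
  by rewrite /F1 big_nat; apply: memv_suml => i i_n; apply/memvZ/adU; lia.
have F3U : F3 \in U.
  by rewrite !memvD ?memvZ ?outU ?inE ?eqxx ?orbT.
have c3U : c3 *: ad br (e 1) \in U by apply/memvZ/adU; lia.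
suff D0 : D2 - F3 = 0.
  have -> : D = c3 *: ad br (e 1) + F3 - F1.
    move/eqP: D0; rewrite subr_eq0 => /eqP <-.
    by rewrite /D2 [(c3 *: _ + _)]addrC subrK addrK.
  by apply: memvB => //; apply: memvD.
have F3e1 : F3 (e 1) = 0.
  by rewrite !add_lfunE !scale_lfunE t1_bv // t2_bv // t3_bv //= !scaler0 !addr0.
have F3e2 : F3 (e 2) = top n *: e n + top (n - 1)%N *: e (n - 1)
    + top (n - 2)%N *: e (n - 2).
  rewrite !add_lfunE !scale_lfunE t1_bv // t2_bv // t3_bv //=.
  by congr (_ *: e _ + _ *: e _ + _ *: e _); lia.
have D2e1 : D2 (e 1) = co 1 (D (e 1)) *: e 1 + co 2 (D (e 1)) *: e 2.
  rewrite add_lfunE opp_lfunE scale_lfunE ad_fbrE fbr_bvv // scaler0 subr0.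
  rewrite add_lfunE sum_lfunE {1}(row_co (D (e 1))).
  rewrite big_ltn; last by lia.
  rewrite big_ltn; last by lia.
  rewrite big_add1 /= -!addrA -big_split /= big_nat big1 ?addr0 // => i i_n.
  by rewrite scale_lfunE ad_fbrE fbrC fbr_e1 ?scalerN ?addrN //; lia.
have D2e2 : co 3 (D2 (e 2)) = 0.
  rewrite add_lfunE opp_lfunE scale_lfunE ad_fbrE fbr_e1 //.
  by rewrite linearB linearZ /= co_bv1 ?mulr1 ?subrr //; lia.
have DerD2 : D2 \in Der br.
  apply: memvB; last exact: subU.
  by apply: memvD => //; apply: subU.
clearbody F3 D2.
apply: (@normalised_derivation_eq0 _ (co 1 (D (e 1))) (co 2 (D (e 1)))).
- by apply/memDer/memvB; last exact: subU.
- by rewrite add_lfunE opp_lfunE F3e1 subr0 D2e1.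
- rewrite add_lfunE opp_lfunE F3e2 !linearB !linearD !linearZ /= D2e2.
  by rewrite !co_bv_neq ?mulr0 ?addr0 ?subrr //; lia.
move=> k lt_k; rewrite add_lfunE opp_lfunE F3e2 linearB !linearD !linearZ /=.
rewrite -/(top k).
have [lt_nk|le_kn] := ltnP n k.
  rewrite !co_bv_neq; try lia.
  rewrite !mulr0 !addr0 subr0 /top /co big1 // => i /eqP ik.
  by have := ltn_ord i; lia.
have [->|kn] := eqVneq k n.
  by rewrite co_bv1 ?co_bv_neq ?mulr0 ?addr0 ?mulr1 ?subrr //; lia.
have [->|kn1] := eqVneq k (n - 1)%N.
  rewrite co_bv1 ?co_bv_neq ?mulr0 ?addr0 ?add0r ?mulr1 ?subrr //; lia.
have -> : k = (n - 2)%N by lia.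
by rewrite co_bv1 ?co_bv_neq ?mulr0 ?addr0 ?add0r ?mulr1 ?subrr //; lia.
Qed.

Lemma Der_raises D k s : D \in Der br -> (0 < k)%N -> (s <= k)%N ->
  co s (D (e k)) = 0.
Proof.
move=> /Der_sub_span DU k0 le_sk; apply: (span_probe DU) => E.
rewrite mem_cat => /orP[/mapP[i]|/outer_bv[h le_h ->]] //.
  by rewrite mem_iota => i_n ->; rewrite ad_fbrE co_fbr_low //; lia.
by case: eqP => _; rewrite ?linear0 // co_bv_neq //; lia.
Qed.

Lemma Der_nilpotent D : D \in Der br -> nilpotent_end D.
Proof.
move=> DerD; exists n => x.
have iter0 t s : (s <= t)%N -> co s (iter t D x) = 0.
  elim: t s => [|t IH] s le_st.
    rewrite (_ : s = 0%N) /co; last by lia.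
    by rewrite big1.
  rewrite iterS (row_co (iter t D x)) !linear_sum big_nat big1 //= => i i_n.
  rewrite !linearZ /=; have [le_it|lt_ti] := leqP i t.
    by rewrite IH ?mul0r.
  by rewrite Der_raises ?mulr0 //; lia.
apply: co_inj => s s_n; rewrite linear0 iter0 //; lia.
Qed.

End FiliformAlgebra.

Theorem proposition4p7 (K : fieldType) (charK0 : [pchar K] =i pred0)
    (n : nat) (le13n : (13 <= n)%N) :
  basis_of (Der (fbr K n))
    ([seq ad (fbr K n) (bv K n i) | i <- iota 1%N (n - 1)%N]
       ++ [:: t1 K n; t2 K n; t3 K n])
  /\ (forall D : 'End('rV[K]_n),
        derivation (fbr K n) D -> nilpotent_end D).
Proof.
split=> [|D /memDer]; last exact: Der_nilpotent.
apply/andP; split; last exact: free_der_basis.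
rewrite eqEsubv; apply/andP; split.
  by apply/span_subvP => E; apply: der_basis_sub.
by apply/subvP => D; apply: Der_sub_span.
Qed.
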